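(* Let $\mathbb{K}$ be an algebraically closed field of characteristic $0$ and let $p\ge 5$ be an integer. Then any $2$-step nilpotent Lie algebra over $\mathbb{K}$ of dimension $2p+1$ with characteristic sequence $(2,\dots,2,1)$ (where $2$ appears $p$ times) is not rigid in $2Nilp_{2p+1}$.
   Context: $2Nilp_n$ is the algebraic variety of all skew-symmetric bilinear maps $\mu:\mathbb{K}^n\times\mathbb{K}^n\to\mathbb{K}^n$ satisfying $\mu(\mu(X,Y),Z)=0$ for all $X,Y,Z$ (viewed in $\mathbb{K}^{n^3}$ via structure constants); a Lie algebra $(\mathbb{K}^n,\mu)$ is identified with $\mu$. The group $GL(n,\mathbb{K})$ acts by $(f\cdot\mu)(X,Y)=f^{-1}\mu(f(X),f(Y))$. $\mu\in 2Nilp_n$ is rigid in $2Nilp_n$ if its orbit is Zariski open in $2Nilp_n$. For a nilpotent Lie algebra $\mathfrak{g}$ and $X\in\mathfrak{g}$, $c(X)$ is the decreasing sequence of the dimensions of the Jordan blocks of the nilpotent operator $\mathrm{ad}(X)$; the characteristic sequence of $\mathfrak{g}$ is $c(\mathfrak{g})=\max\{c(X): X\in\mathfrak{g}\setminus[\mathfrak{g},\mathfrak{g}]\}$ for the lexicographic order. *)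

(* Defs.v *)
(* MathComp, with multinomials for polynomials in several variables *)
From HB Require Import structures.
From mathcomp Require Export all_boot all_order all_algebra.
From mathcomp Require Export mpoly.

Set Implicit Arguments.
Unset Strict Implicit.
Unset Printing Implicit Defensive.

Import GRing.Theory.
Local Open Scope ring_scope.

Section Zariski.

Variables (K : fieldType) (N : nat).

Definition zariski_closed (Z : ('I_N -> K) -> Prop) : Prop :=
  exists S : {mpoly K[N]} -> Prop,
    forall x, Z x <-> (forall q, S q -> q.@[x] = 0).

Definition zariski_open (U : ('I_N -> K) -> Prop) : Prop :=
  zariski_closed (fun x => ~ U x).

End Zariski.

Section JordanType.

Variable K : fieldType.

Definition nil_jordan_block (m : nat) : 'M[K]_m :=
  \matrix_(i, j) (i.+1 == j :> nat)%:R.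

(* [A] is nilpotent and [s] is the decreasing sequence of the sizes of its
   Jordan blocks. The rows of [P] are a Jordan basis; [row_free] and [row_full]
   together force the total size of the blocks to be [n]. *)
Definition nil_jordan_type (n : nat) (A : 'M[K]_n) (s : seq nat) : Prop :=
  [/\ sorted geq s, 0%N \notin s
    & exists P : 'M[K]_(\sum_(i < size s) nth 0%N s i, n),
        [/\ row_free P, row_full P
          & P *m A
            = (\mxdiag_(i < size s) nil_jordan_block (nth 0%N s i)) *m P]].

End JordanType.

Section TwoStepNilpotent.

Variables (K : fieldType) (n : nat).

Definition bilinear_law : Type :=
  {bilinear 'rV[K]_n -> 'rV[K]_n -> 'rV[K]_n}.

Implicit Types mu nu : bilinear_law.

(* The Jacobi identity follows from the second condition. *)
Definition two_nilp mu : Prop :=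
  (forall X Y, mu X Y = - mu Y X) /\ (forall X Y Z, mu (mu X Y) Z = 0).

(* The coordinates of [mu] in affine n^3-space: for the index t corresponding
   to (i, j, k), the coefficient of e_k in mu(e_i, e_j). *)
Definition structure_constants mu :
    'I_#|{: 'I_n * 'I_n * 'I_n}| -> K :=
  fun t => let: (i, j, k) := enum_val t in
           mu (delta_mx 0 i) (delta_mx 0 j) 0 k.

(* [f] in GL(n, K) acts on row vectors by right multiplication, so that
   this reads nu(X, Y) = f^-1(mu(f X, f Y)). *)
Definition in_orbit mu nu : Prop :=
  exists2 f : 'M[K]_n, f \in unitmx &
    forall X Y, nu X Y = mu (X *m f) (Y *m f) *m invmx f.

(* The orbit of [mu] is open for the topology induced on the variety of
   2-step nilpotent laws by the Zariski topology of affine n^3-space. *)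
Definition rigid mu : Prop :=
  exists2 U : ('I_#|{: 'I_n * 'I_n * 'I_n}| -> K) -> Prop, zariski_open U &
    forall nu, two_nilp nu -> (in_orbit mu nu <-> U (structure_constants nu)).

(* [mu, mu] is the linear span of the brackets, not just the set of them. *)
Definition in_derived mu (X : 'rV[K]_n) : Prop :=
  exists (m : nat) (a : 'I_m -> K) (Y Z : 'I_m -> 'rV[K]_n),
    X = \sum_(i < m) a i *: mu (Y i) (Z i).

(* Row-vector convention: Y *m ad mu X = mu X Y. *)
Definition ad mu (X : 'rV[K]_n) : 'M[K]_n := lin1_mx (mu X).

(* [s] is the maximum of the Jordan types of ad(X), X outside [mu, mu], for the
   lexicographic order (which is the order carried by [seqlexi nat]). *)
Definition characteristic_sequence mu (s : seq nat) : Prop :=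
  (exists2 X, ~ in_derived mu X & nil_jordan_type (ad mu X) s) /\
  (forall X t, ~ in_derived mu X -> nil_jordan_type (ad mu X) t ->
     ((t : seqlexi nat) <= (s : seqlexi nat))%O).

End TwoStepNilpotent.

(* Main.v *)
(* Let X realise the characteristic sequence. Every central subspace W lies in
   ker(ad X) and misses X, so dim W < n - rank(ad X); applied to im(ad X) and to
   im(ad X) plus a bracket, this gives [g, g] = Z(g) = im(ad X), of dimension p.
   Hence g is given by a map from the second exterior power of V = g / Z(g), of
   dimension p + 1, to Z(g). If the orbit were open, the image of the polynomial
   action map (G, H) of End(V) x End(Z(g)) on such maps would contain a nonempty
   open subset of a space of dimension p * C(p + 1, 2). For p >= 5 this exceeds
   the number (p + 1)^2 + p^2 of variables, so the components of the action map
   are algebraically dependent, a contradiction. *)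
Require Import Defs.
From HB Require Import structures.
From mathcomp Require Import all_boot all_order all_algebra.
From mathcomp Require Import mpoly zify.

Set Implicit Arguments.
Unset Strict Implicit.
Unset Printing Implicit Defensive.

Import GRing.Theory.
Local Open Scope ring_scope.

(** * Polynomials vanishing at every point, in characteristic 0 *)

Lemma poly_natr_eq0 (K : fieldType) (charK : [pchar K] =i pred0)
    (r : {poly K}) : (forall n : nat, r.[n%:R] = 0) -> r = 0.
Proof.
move=> r0; apply: (@roots_geq_poly_eq0 _ _ [seq n%:R | n <- iota 0 (size r)]).
- by apply/allP => _ /mapP[n _ ->]; rewrite rootE r0.
- rewrite map_inj_uniq ?iota_uniq // => m n /eqP.
  wlog le_mn : m n / (m <= n)%N => [wl|].
    by case: (leqP m n) => [|/ltnW] /wl // h; rewrite eq_sym => /h.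
  rewrite eq_sym -subr_eq0 -natrB // (pcharf0P _).1 // subn_eq0 => le_nm.
  by apply/eqP; rewrite eqn_leq le_mn.
- by rewrite size_map size_iota.
Qed.

(** Induction on the number of variables: [coefp k] collects the terms of degree [k] in the last
    variable. With the other variables fixed at [v], [p] becomes a univariate polynomial [r]
    vanishing at all naturals, so every [coefp k] vanishes at [v]. *)
Lemma mpoly_vanish_eq0 (K : fieldType) (charK : [pchar K] =i pred0)
    (n : nat) (p : {mpoly K[n]}) : (forall v, p.@[v] = 0) -> p = 0.
Proof.
elim: n p => [|n IHn] p p0.
  apply/mpolyP => m; rewrite mcoeff0; move: (p0 (fun=> 0)).
  rewrite [p]mpolyE raddf_sum /= => <-.
  rewrite [LHS]raddf_sum /=; apply: eq_bigr => i _.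
  rewrite mevalZ mcoeffZ mevalX big_ord0 mcoeffX.
  by rewrite (_ : i == m) //; apply/eqP/mnmP => -[].
pose low (m : 'X_{1..n.+1}) := [multinom m (widen_ord (leqnSn n) i) | i < n].
have low_inj (m m' : 'X_{1..n.+1}) : m ord_max = m' ord_max -> low m = low m' -> m = m'.
  move=> eq_max /mnmP eq_low; apply/mnmP => i.
  have [lt_in|] := ltnP i n; last first.
    move=> le_ni; suff -> : i = ord_max by [].
    by apply/val_inj/eqP; rewrite /= eqn_leq le_ni -ltnS ltn_ord.
  by move: (eq_low (Ordinal lt_in)); rewrite !mnmE (_ : widen_ord _ _ = i) //;
     apply/val_inj.
pose coefp k := \sum_(m <- msupp p | m ord_max == k) p@_m *: 'X_[K, low m].
have coefp0 k : coefp k = 0.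
  apply: IHn => v.
  pose r : {poly K} := \sum_(m <- msupp p)
    (p@_m * \prod_(i < n) v i ^+ low m i) *: 'X^(m ord_max).
  have r0 : r = 0.
    apply: (poly_natr_eq0 charK) => t.
    (* This point has first coordinates [v] and last coordinate [t]: [insub] fails only at the last
       index, where the default is used. *)
    rewrite -[RHS](p0 (fun i => oapp v t%:R (insub (val i)))).
    rewrite mevalE horner_sum; apply: eq_bigr => m _.
    rewrite hornerZ hornerXn -mulrA big_ord_recr /=.
    rewrite insubN ?ltnn //=; congr (_ * (_ * _)).
    apply: eq_bigr => i _; rewrite mnmE; congr (_ ^+ _).
    by rewrite insubT /= => [|lt_in]; [exact: ltn_ord | congr v; apply/val_inj].
  have := congr1 (fun u : {poly K} => u`_k) r0; rewrite coef0 => <-.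
  rewrite coef_sum raddf_sum /= big_mkcond; apply: eq_bigr => m _.
  rewrite coefZ coefXn mevalZ mevalX eq_sym.
  by case: eqP; rewrite ?mulr1 ?mulr0.
apply/mpolyP => m; rewrite mcoeff0.
have [m_p|] := boolP (m \in msupp p); last exact: memN_msupp_eq0.
have := congr1 (mcoeff (low m)) (coefp0 (m ord_max)).
rewrite mcoeff0 raddf_sum /= big_mkcond (bigD1_seq m) ?msupp_uniq //= eqxx.
rewrite mcoeffZ mcoeffX eqxx mulr1 big1 ?addr0 // => m' neq.
case: eqP => // eq_max; rewrite mcoeffZ mcoeffX.
case: eqP => [/(low_inj _ _ eq_max) eqm|_]; last by rewrite mulr0.
by rewrite eqm eqxx in neq.
Qed.

(** * Algebraic dependence of polynomials outnumbering their variables *)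

Lemma msizeM_leS (K : fieldType) n (p q : {mpoly K[n]}) s t :
  (msize p <= s.+1)%N -> (msize q <= t.+1)%N -> (msize (p * q) <= (s + t).+1)%N.
Proof.
move=> ps qt; have [->|p0] := eqVneq p 0; first by rewrite mul0r msize0.
have [->|q0] := eqVneq q 0; first by rewrite mulr0 msize0.
rewrite msizeM // -subn1 leq_subLR (leq_trans (leq_add ps qt)) //.
by rewrite addSn addnS add1n.
Qed.

Lemma msize_prodX_le (K : fieldType) n m (phi : 'I_m -> {mpoly K[n]})
    (e : 'I_m -> nat) D :
  (forall i, (msize (phi i) <= D.+1)%N) ->
  (msize (\prod_i phi i ^+ e i) <= (D * \sum_i e i).+1)%N.
Proof.
move=> phiD; rewrite big_distrr /=.
apply: (big_ind2 (fun p s => (msize p <= s.+1)%N)) => [|????|i _].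
- by rewrite msize1.
- exact: msizeM_leS.
elim: (e i) => [|k IHk]; first by rewrite expr0 msize1.
by rewrite exprS mulnS; apply: msizeM_leS.
Qed.

Lemma card_bmultinom_le n b : (#|{: 'X_{1..n < b}}| <= b ^ n)%N.
Proof.
have ltb (m : 'X_{1..n < b}) i : (m i < b)%N.
  apply: leq_ltn_trans (bmdeg m).
  by rewrite mdegE (bigD1 i) //= leq_addr.
pose f (m : 'X_{1..n < b}) := [ffun i => Ordinal (ltb m i)].
have f_inj : injective f.
  move=> m m' /ffunP eq_f; apply/val_inj/mnmP => i.
  by move: (eq_f i); rewrite !ffunE => -[].
by apply: leq_trans (leq_card f f_inj) _; rewrite card_ffun !card_ord.
Qed.

(* The monomials in the [phi i] with exponents less than [d] are [d ^ m]
   polynomials in a space of dimension [O(d ^ n)]. *)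
Lemma mpoly_algebraic_dependence (K : fieldType) (n m : nat)
    (phi : 'I_m -> {mpoly K[n]}) :
  (n < m)%N ->
  exists2 P : {mpoly K[m]}, P != 0 & forall x, P.@[fun i => (phi i).@[x]] = 0.
Proof.
move=> lt_nm; pose D := (\max_i msize (phi i))%N.
have phiD i : (msize (phi i) <= D.+1)%N.
  by apply: leqW; apply: (leq_bigmax (F := fun i => msize (phi i))).
(* Products with exponents below [d] have degree less than [b], so they lie in a space of dimension
   at most [b ^ n = C ^ n * d ^ n]. Taking [d] above [C ^ n] makes this smaller than [d ^ n.+1],
   hence than [d ^ m]. *)
pose C := (D * m).+1; pose d := (C ^ n).+1; pose b := (C * d)%N.
pose E := {ffun 'I_m -> 'I_d}.
pose mon (e : E) := \prod_i phi i ^+ e i.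
have mon_b e : (msize (mon e) <= b)%N.
  apply: leq_trans (msize_prodX_le _ phiD) _.
  rewrite /b /C mulSn -mulnA -addn1 addnC leq_add // leq_mul2l.
  rewrite -[X in (_ <= X * _)%N]card_ord -sum_nat_const leq_sum ?orbT //.
  by move=> i _; apply: ltnW.
have card_lt : (#|{: 'X_{1..n < b}}| < #|E|)%N.
  apply: leq_ltn_trans (card_bmultinom_le _ _) _.
  rewrite card_ffun !card_ord /b expnMn.
  apply: (@leq_trans (d ^ n.+1)); last by rewrite leq_pexp2l.
  by rewrite expnS ltn_pmul2r ?expn_gt0.
pose M : 'M[K]_(#|E|, #|{: 'X_{1..n < b}}|) :=
  \matrix_(i, j) (mon (enum_val i))@_(enum_val j : 'X_{1..n < b}).
have /rowV0Pn[u /sub_kermxP uM u0] : kermx M != 0.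
  rewrite -mxrank_eq0 mxrank_ker subn_eq0 -ltnNge.
  exact: leq_ltn_trans (rank_leq_col _) card_lt.
pose mnm (e : E) := [multinom (e i : nat) | i < m].
have mnm_inj : injective mnm.
  move=> e e' /mnmP eq_e; apply/ffunP => i; apply/val_inj.
  by move: (eq_e i); rewrite !mnmE.
pose P := \sum_i u 0 i *: 'X_[K, mnm (enum_val i)].
have u_mon : \sum_i u 0 i *: mon (enum_val i) = 0.
  apply/mpolyP => m'; rewrite mcoeff0.
  have [lt_m'b|le_bm'] := ltnP (mdeg m') b; last first.
    rewrite raddf_sum big1 //= => i _.
    rewrite mcoeffZ memN_msupp_eq0 ?mulr0 // msize_mdeg_ge //.
    exact: leq_trans (mon_b _) le_bm'.
  have := congr1 (fun B : 'rV_ _ => B 0 (enum_rank (BMultinom lt_m'b))) uM.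
  rewrite !mxE => <-; rewrite raddf_sum /=; apply: eq_bigr => i _.
  by rewrite mcoeffZ mxE enum_rankK.
exists P => [|x].
  apply: contraNneq u0 => P0; apply/eqP/rowP => i; rewrite mxE.
  have := congr1 (mcoeff (mnm (enum_val i))) P0.
  rewrite mcoeff0 raddf_sum (bigD1 i) //= mcoeffZ mcoeffX eqxx mulr1.
  rewrite big1 ?addr0 //; move=> j ne_ji; rewrite mcoeffZ mcoeffX.
  by rewrite (inj_eq mnm_inj) (inj_eq enum_val_inj) (negPf ne_ji) mulr0.
have := congr1 (meval x) u_mon; rewrite meval0 => <-.
rewrite !raddf_sum; apply: eq_bigr => i _ /=.
rewrite !mevalZ mevalX rmorph_prod; congr (_ * _); apply: eq_bigr => j _ /=.
by rewrite mnmE rmorphXn.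
Qed.

(** * Bilinear laws built from tensors *)

Lemma eq_opp_eq0 (K : fieldType) (charK : [pchar K] =i pred0) (x : K) :
  x = - x -> x = 0.
Proof.
move/eqP; rewrite -addr_eq0 -mulr2n -mulr_natr mulf_eq0.
by rewrite (pcharf0P _).1 // orbF => /eqP.
Qed.

Lemma scalemx_coef (R : pzRingType) m n (a : R) (A : 'M[R]_(m, n)) i j :
  (a *: A) i j = a * A i j.
Proof. by rewrite mxE. Qed.

(* A tensor [A] stands for the bilinear map [(e_i, e_j) |-> row j (A i)]; it is
   pulled back along [G] and its values are pushed forward along [H]. *)
Definition tensor_act (R : comNzRingType) (m q r s : nat) (G : 'M[R]_(m, q))
    (H : 'M[R]_(r, s)) (A : 'I_q -> 'M[R]_(q, r)) (i : 'I_m) : 'M[R]_(m, s) :=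
  G *m (\sum_j G i j *: A j) *m H.

Lemma map_tensor_act (R R' : comNzRingType) (f : {rmorphism R -> R'})
    (m q r s : nat) (G : 'M[R]_(m, q)) (H : 'M[R]_(r, s))
    (A : 'I_q -> 'M[R]_(q, r)) (i : 'I_m) :
  map_mx f (tensor_act G H A i)
  = tensor_act (map_mx f G) (map_mx f H) (fun j => map_mx f (A j)) i.
Proof.
rewrite /tensor_act !map_mxM raddf_sum /=; congr (_ *m _ *m _).
by apply: eq_bigr => j _; rewrite map_mxZ mxE.
Qed.

Lemma tensor_act_mulr (R : comNzRingType) (m q r s s' : nat) (G : 'M[R]_(m, q))
    (H : 'M[R]_(r, s)) (M : 'M[R]_(s, s')) (A : 'I_q -> 'M[R]_(q, r)) (i : 'I_m) :
  tensor_act G H A i *m M = tensor_act G (H *m M) A i.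
Proof. by rewrite /tensor_act mulmxA. Qed.

Section TensorLaw.

Variables (K : fieldType) (n q r : nat) (pi : 'M[K]_(n, q)) (io : 'M[K]_(r, n)).

(** Here [pi] stands for the projection of the algebra onto its quotient V and [io] for the
    inclusion of the centre Z. *)
Definition tensor_law (A : 'I_q -> 'M[K]_(q, r)) (X Y : 'rV[K]_n) : 'rV[K]_n :=
  Y *m pi *m (\sum_i (X *m pi) 0 i *: A i) *m io.

Lemma tensor_law_bilinear A : bilinear_for *:%R *:%R (tensor_law A).
Proof.
split=> [Y c X X' | X c Y Y']; rewrite /tensor_law /=.
  rewrite scalemxAl scalemxAr -mulmxDl -mulmxDr scaler_sumr -big_split /=.
  congr (_ *m _ *m _); apply: eq_bigr => i _.
  by rewrite mulmxDl -scalemxAl !mxE scalerDl scalerA.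
by rewrite !mulmxDl -!scalemxAl.
Qed.

HB.instance Definition _ A :=
  bilinear_isBilinear.Build K _ _ _ _ _ (tensor_law A) (tensor_law_bilinear A).

(** Serves twice: with [G = 1] it yields the structure constants, and with lifts of a basis of V it
    recovers the tensor from the law. *)
Lemma tensor_law_row m (G : 'M[K]_(m, n)) A i j :
  tensor_law A (row i G) (row j G) = row j (tensor_act (G *m pi) io A i).
Proof.
rewrite /tensor_law /tensor_act !row_mul; congr (_ *m _ *m _).
by apply: eq_bigr => k _; rewrite -row_mul mxE.
Qed.

Lemma tensor_law_delta A i j k :
  tensor_law A (delta_mx 0 i) (delta_mx 0 j) 0 k = tensor_act pi io A i j k.
Proof. by rewrite -!row1 tensor_law_row mul1mx mxE. Qed.

Lemma tensor_law_skew (A : 'I_q -> 'M[K]_(q, r)) :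
  (forall i j k, A i j k = - A j i k) ->
  forall X Y, tensor_law A X Y = - tensor_law A Y X.
Proof.
move=> skewA X Y; rewrite /tensor_law -mulNmx; congr (_ *m _).
apply/rowP => k; rewrite [LHS]mxE [RHS]mxE [in RHS]mxE -sumrN.
transitivity (\sum_j \sum_i (Y *m pi) 0 j * ((X *m pi) 0 i * A i j k)).
  by apply: eq_bigr => j _; rewrite summxE mulr_sumr; apply: eq_bigr => i _;
     rewrite scalemx_coef.
rewrite exchange_big; apply: eq_bigr => i _ /=.
rewrite summxE mulr_sumr -sumrN; apply: eq_bigr => j _.
by rewrite scalemx_coef skewA !mulrN mulrCA.
Qed.

Lemma tensor_law_two_nilp (A : 'I_q -> 'M[K]_(q, r)) :
  io *m pi = 0 -> (forall i j k, A i j k = - A j i k) ->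
  two_nilp (tensor_law A).
Proof.
move=> io_pi skewA; split=> [|X Y Z]; first exact: tensor_law_skew.
rewrite /= [LHS]/tensor_law. rewrite big1 ?mulmx0 ?mul0mx // => i _.
by rewrite /tensor_law -[_ *m io *m pi]mulmxA io_pi mulmx0 mxE scale0r.
Qed.

End TensorLaw.

Lemma map_mx_mevalC (R : comNzRingType) (N m n : nat) (v : 'I_N -> R)
    (A : 'M[R]_(m, n)) :
  map_mx (meval v) (map_mx (@mpolyC N R) A) = A.
Proof. by apply/matrixP => i j; rewrite !mxE mevalC. Qed.

(** * Coordinates on the space of skew-symmetric tensors *)

Definition skew_index (q r : nat) : predArgType :=
  {t : 'I_q * 'I_q * 'I_r | (t.1.1 < t.1.2)%N}.

Lemma card_skew_index q r : #|{: skew_index q r}| = ('C(q, 2) * r)%N.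
Proof.
rewrite card_sig -sum1_card.
transitivity (\sum_(u : 'I_q * 'I_q | u.1 < u.2) \sum_(k < r) 1)%N.
  rewrite pair_big_dep; apply: eq_bigl => t; rewrite andbT.
  by rewrite unfold_in.
rewrite (eq_bigr (fun=> 1 * r)%N) => [|? _].
  2: by rewrite mul1n sum1_card card_ord.
rewrite -big_distrl /=; congr (_ * r)%N.
transitivity (\sum_(i < q) \sum_(j < q | i < j) 1)%N.
  by rewrite pair_big_dep.
rewrite (exchange_big_dep xpredT) //= -bin2_sum big_mkord.
apply: eq_bigr => j _; rewrite sum1_card.
rewrite -[RHS]card_ord -(card_image (f := widen_ord (ltnW (ltn_ord j)))); last first.
  by move=> i i' /(congr1 val) /= /val_inj.
apply: eq_card => i; apply/idP/imageP => [lt_ij|[i' _ ->]].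
  by exists (Ordinal lt_ij) => //; apply/val_inj.
exact: (ltn_ord i').
Qed.

(** At most one of the two [insub] succeeds, and neither does when [i = j]. The coefficients may be
    scalars or polynomials, so the generic skew tensor is an instance too. *)
Definition skew_tensor (R : zmodType) (q r : nat) (x : skew_index q r -> R)
    (i : 'I_q) : 'M[R]_(q, r) :=
  \matrix_(j, k) (oapp x 0 (insub (i, j, k)) - oapp x 0 (insub (j, i, k))).

Lemma skew_tensor_skew (R : zmodType) (q r : nat) (x : skew_index q r -> R) i j k :
  skew_tensor x i j k = - skew_tensor x j i k.
Proof. by rewrite !mxE opprB. Qed.

Lemma skew_tensorE (R : zmodType) (q r : nat) (x : skew_index q r -> R) t :
  skew_tensor x (val t).1.1 (val t).1.2 (val t).2 = x t.
Proof.
rewrite mxE; case: t => -[[i j] k] /= lt_ij.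
by rewrite insubT insubN ?subr0 //= -leqNgt ltnW.
Qed.

Lemma eq_skew_tensor (R : zmodType) (q r : nat) (x y : skew_index q r -> R) :
  x =1 y -> skew_tensor x =1 skew_tensor y.
Proof.
move=> eq_xy i; apply/matrixP => j k; rewrite !mxE.
by congr (_ - _); case: insub => /=.
Qed.

Lemma map_skew_tensor (R R' : zmodType) (f : {additive R -> R'}) (q r : nat)
    (x : skew_index q r -> R) i :
  map_mx f (skew_tensor x i) = skew_tensor (f \o x) i.
Proof.
have fE o : f (oapp x 0 o) = oapp (f \o x) 0 o by case: o => /=; rewrite ?raddf0.
by apply/matrixP => j k; rewrite !mxE raddfB !fE.
Qed.

(** The entries with [i = j] equal their opposites, hence vanish in characteristic 0. *)
Lemma skew_tensorK (K : fieldType) (charK : [pchar K] =i pred0) (q r : nat)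
    (A : 'I_q -> 'M[K]_(q, r)) :
  (forall i j k, A i j k = - A j i k) ->
  forall i, A i
  = skew_tensor (fun t : skew_index q r => A (val t).1.1 (val t).1.2 (val t).2) i.
Proof.
move=> skewA i; apply/matrixP => j k; rewrite mxE.
case: (ltngtP i j) => [lt_ij|lt_ji|/val_inj <-].
- by rewrite insubT insubN ?subr0 //= -leqNgt ltnW.
- by rewrite [insub (i, j, k)]insubN ?insubT ?sub0r -?skewA //= -leqNgt ltnW.
by rewrite subrr; apply: (eq_opp_eq0 charK).
Qed.

(** * Non-rigidity by a parameter count *)

Section NotRigid.

Variables (K : fieldType) (n q r : nat) (mu : bilinear_law K n).
Variables (pi : 'M[K]_(n, q)) (si : 'M[K]_(q, n)).
Variables (io : 'M[K]_(r, n)) (rho : 'M[K]_(n, r)).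
Hypotheses (charK : [pchar K] =i pred0) (mu_nilp : two_nilp mu).
Hypotheses (io_pi : io *m pi = 0) (si_pi : si *m pi = 1%:M).
Hypothesis io_rho : io *m rho = 1%:M.
Hypothesis mu_factor :
  forall X Y, mu X Y = mu (X *m pi *m si) (Y *m pi *m si) *m rho *m io.

(** The tensor of [mu]: the section [si] lifts the basis of V, and the retraction [rho] of [io]
    reads off coordinates in Z. *)
Let A0 (i : 'I_q) : 'M[K]_(q, r) :=
  \matrix_(j, k) (mu (row i si) (row j si) *m rho) 0 k.

Let A0_skew i j k : A0 i j k = - A0 j i k.
Proof. by rewrite [LHS]mxE [in RHS]mxE mu_nilp.1 mulNmx [LHS]mxE. Qed.

Let mu_tensor X Y : mu X Y = tensor_law pi io A0 X Y.
Proof.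
rewrite mu_factor /tensor_law; congr (_ *m _).
rewrite (mulmx_sum_row (X *m pi)) (mulmx_sum_row (Y *m pi)).
rewrite linear_sumlz mulmx_suml; apply/rowP => k; rewrite summxE [RHS]mxE.
transitivity (\sum_i \sum_j (Y *m pi) 0 j * ((X *m pi) 0 i * A0 i j k)).
  apply: eq_bigr => i _; rewrite linearZl_LR linear_sumr -scalemxAl.
  rewrite scalemx_coef mulmx_suml summxE mulr_sumr; apply: eq_bigr => j _.
  by rewrite linearZr_LR -scalemxAl scalemx_coef mulrCA [A0 _ _ _]mxE.
rewrite exchange_big; apply: eq_bigr => j _ /=; rewrite -mulr_sumr summxE.
by congr (_ * _); apply: eq_bigr => i _; rewrite scalemx_coef.
Qed.

(** If [f] carries [mu] to the law of [A], then [G] and [H] are the compressions of [f] to V and of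
    its inverse to Z; compare the two laws on the rows of [si], then apply [rho]. *)
Lemma orbit_tensor_act (A : 'I_q -> 'M[K]_(q, r)) :
  Defs.in_orbit mu (tensor_law pi io A) ->
  exists (G : 'M[K]_q) (H : 'M[K]_r), forall i, A i = tensor_act G H A0 i.
Proof.
case=> f f_unit eq_law; exists (si *m f *m pi), (io *m invmx f *m rho) => i.
apply/row_matrixP => j; have := congr1 (mulmx^~ rho) (eq_law (row i si) (row j si)).
rewrite /= -!row_mul mu_tensor !tensor_law_row si_pi -!row_mul.
rewrite !tensor_act_mulr io_rho => eq_row.
rewrite -eq_row /tensor_act mul1mx mulmx1 (bigD1 i) //= mxE eqxx scale1r.
by rewrite big1 ?addr0 // => i' ne; rewrite mxE eq_sym (negPf ne) scale0r.
Qed.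

(** A nonzero [P] vanishes at all tensors whose law is in the orbit. An equation [s] of the
    complement of [U] pulls back to a polynomial [Q] vanishing at all other tensors. So [P * Q = 0],
    whence [Q = 0] and [s] vanishes at [mu]; this puts [mu] outside [U], although it lies in its own
    orbit. *)
Lemma tensor_law_not_rigid :
  (q * q + r * r < 'C(q, 2) * r)%N -> ~ rigid mu.
Proof.
move=> lt_dim [U [S US] rigU].
pose T := skew_index q r; pose I := ('I_q * 'I_q + 'I_r * 'I_r)%type.
pose X (u : I) := 'X_(enum_rank u) : {mpoly K[#|{: I}|]}.
pose Gx : 'M_q := \matrix_(i, j) X (inl (i, j)).
pose Hx : 'M_r := \matrix_(i, j) X (inr (i, j)).
pose Ax i := map_mx (@mpolyC #|{: I}| K) (A0 i).
(* The components of the action map at [A0], with the entries of [G] and [H] as indeterminates. *)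
pose phi (s : 'I_#|{: T}|) :=
  let t := val (enum_val s) in tensor_act Gx Hx Ax t.1.1 t.1.2 t.2.
have [|P P0 Pphi] := mpoly_algebraic_dependence phi.
  by rewrite card_skew_index card_sum !card_prod !card_ord.
pose nu (x : 'I_#|{: T}| -> K) : bilinear_law K n :=
  tensor_law pi io (skew_tensor (fun t => x (enum_rank t))).
have nu_nilp x : two_nilp (nu x).
  by apply: tensor_law_two_nilp => // *; apply: skew_tensor_skew.
(* The structure constants of [nu x], as polynomials in [x]. *)
pose C (s : 'I_#|{: 'I_n * 'I_n * 'I_n}|) :=
  let: (i, j, k) := enum_val s in
  tensor_act (map_mx (@mpolyC #|{: T}| K) pi) (map_mx (@mpolyC #|{: T}| K) io)
    (skew_tensor (fun t : T => 'X_(enum_rank t))) i j k.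
have CE x s : (C s).@[x] = structure_constants (nu x) s.
  rewrite /C /structure_constants; case: (enum_val s) => [[i j] k].
  rewrite /nu /= tensor_law_delta.
  have := map_tensor_act (meval x) (map_mx (@mpolyC #|{: T}| K) pi)
    (map_mx (@mpolyC #|{: T}| K) io)
    (skew_tensor (fun t : T => 'X_(enum_rank t))) i.
  move=> /matrixP/(_ j k); rewrite mxE => ->; rewrite !map_mx_mevalC.
  rewrite /tensor_act; congr ((_ *m _ *m _) _ _); apply: eq_bigr => l _.
  congr (_ *: _); rewrite map_skew_tensor; apply: eq_skew_tensor => t /=.
  exact: mevalXU.
have orbitP x : Defs.in_orbit mu (nu x) -> P.@[x] = 0.
  move=> /orbit_tensor_act[G [H eqA]].
  pose v (u : 'I_#|{: I}|) := match enum_val u with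
    | inl (i, j) => G i j | inr (i, j) => H i j end.
  rewrite -(Pphi v); apply: meval_eq => s; rewrite /phi.
  set t := enum_val s; move: (map_tensor_act (meval v) Gx Hx Ax (val t).1.1).
  move=> /matrixP/(_ (val t).1.2 (val t).2); rewrite mxE => ->.
  have -> : map_mx (meval v) Gx = G.
    by apply/matrixP => i j; rewrite !mxE mevalXU /v enum_rankK.
  have -> : map_mx (meval v) Hx = H.
    by apply/matrixP => i j; rewrite !mxE mevalXU /v enum_rankK.
  transitivity (tensor_act G H A0 (val t).1.1 (val t).1.2 (val t).2).
    by rewrite -eqA skew_tensorE enum_valK.
  rewrite /tensor_act; congr ((_ *m _ *m _) _ _); apply: eq_bigr => l _.
  by congr (_ *: _); rewrite map_mx_mevalC.
have mu_U : U (structure_constants mu).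
  apply/(rigU mu mu_nilp); exists 1%:M => [|Y Z]; first exact: unitmx1.
  by rewrite invmx1 !mulmx1.
suff /US : forall s, S s -> s.@[structure_constants mu] = 0 by [].
move=> s Ss; pose Q := s \mPo [tuple C j | j < _].
have QE x : Q.@[x] = s.@[structure_constants (nu x)].
  by rewrite comp_mpoly_meval; apply: meval_eq => j; rewrite tnth_mktuple CE.
have PQ0 : P * Q = 0.
  apply: mpoly_vanish_eq0 => // x; rewrite mevalM.
  have [->|Px0] := eqVneq P.@[x] 0; first by rewrite mul0r.
  rewrite QE (US _).1 ?mulr0 // => /(rigU _ (nu_nilp x))/orbitP Px.
  by rewrite Px eqxx in Px0.
have /eqP Q0 : Q == 0 by move/eqP: PQ0; rewrite mulf_eq0 (negPf P0).
(* The coordinates of [A0], for which [nu x0] is [mu]. *)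
pose x0 (i : 'I_#|{: T}|) := let t := val (enum_val i) in A0 t.1.1 t.1.2 t.2.
transitivity Q.@[x0]; last by rewrite Q0 meval0.
rewrite QE; apply: meval_eq => i; rewrite /structure_constants.
case: (enum_val i) => [[a b] c]; congr (_ 0 c); rewrite mu_tensor /=.
rewrite /tensor_law; congr (_ *m _ *m _); apply: eq_bigr => l _.
congr (_ *: _); rewrite (skew_tensorK charK A0_skew).
by apply: eq_skew_tensor => t; rewrite /x0 enum_rankK.
Qed.

End NotRigid.

(** * Rank of ad(X) and position of the derived algebra *)

(** Each of the [p] blocks of size 2 has a nonzero entry, so it adds at least 1 to the rank. *)
Lemma rank_jordan_type_21 (K : fieldType) (n p : nat) (A : 'M[K]_n) :
  nil_jordan_type A (rcons (nseq p 2%N) 1%N) -> (p <= \rank A)%N.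
Proof.
set s := rcons _ _; case=> _ _ [P [P_free _ PA]].
apply: leq_trans (mxrankM_maxr P A); rewrite PA mxrankMfree // rank_mxdiag.
have sz : size s = p.+1 by rewrite size_rcons size_nseq.
have rank2 : (0 < \rank (nil_jordan_block K 2))%N.
  rewrite lt0n mxrank_eq0; apply/eqP => /matrixP/(_ ord0 ord_max) /eqP.
  by rewrite !mxE oner_eq0.
apply: (@leq_trans (\sum_(i < size s) (i < p))%N).
  rewrite sz big_ord_recr /= ltnn addn0 (eq_bigr (fun=> 1%N)).
    by rewrite sum1_card card_ord.
  by move=> i _; rewrite ltn_ord.
apply: leq_sum => i _; case: ltnP => // lt_ip.
by rewrite nth_rcons size_nseq lt_ip nth_nseq lt_ip.
Qed.

Section DerivedAlgebra.

Variables (K : fieldType) (n : nat) (mu : bilinear_law K n) (X : 'rV[K]_n).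
Hypotheses (charK : [pchar K] =i pred0) (mu_nilp : two_nilp mu).

Let A := ad mu X.

Let mulA Y : Y *m A = mu X Y.
Proof. exact: mul_rV_lin1. Qed.

Let muxx Y : mu Y Y = 0.
Proof.
apply/rowP => k; rewrite mxE; apply: (eq_opp_eq0 charK).
by rewrite [in LHS]mu_nilp.1 mxE.
Qed.

Lemma ad_image_central v Y : (v <= A)%MS -> mu v Y = 0.
Proof. by case/submxP => W ->; rewrite mulA mu_nilp.2. Qed.

Lemma rank_central_lt m (W : 'M[K]_(m, n)) :
  A != 0 -> (forall v Y, (v <= W)%MS -> mu v Y = 0) -> (\rank W + \rank A < n)%N.
Proof.
move=> A0 Wc; rewrite addnC -ltn_subRL -mxrank_ker.
have XW : ~~ (X <= W)%MS.
  apply: contra A0 => XW; apply/eqP/row_matrixP => i.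
  by rewrite row0 rowE mulA Wc.
suff ltW : (W < W + X)%MS.
  apply: leq_trans (rank_ltmx ltW) _ => //.
  apply: mxrankS; rewrite addsmx_sub; apply/andP; split.
    apply/rV_subP => v vW; apply/sub_kermxP.
    by rewrite mulA mu_nilp.1 Wc ?oppr0.
  by apply/sub_kermxP; rewrite mulA muxx.
rewrite /ltmx addsmxSl; apply: contra XW; apply: submx_trans.
exact: addsmxSr.
Qed.

(** A bracket outside im(ad X) would enlarge it to a central subspace of rank at least
    [(\rank A).+1], and [rank_central_lt] would give [(\rank A).*2.+1 < n]. *)
Lemma derived_sub_ad_image Y Z : A != 0 -> (n <= (\rank A).*2.+1)%N ->
  (mu Y Z <= A)%MS.
Proof.
move=> A0 le_n; apply: contraTT le_n => cA; rewrite -ltnNge.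
have ltA : (A < A + mu Y Z)%MS.
  by rewrite /ltmx addsmxSl; apply: contra cA; apply: submx_trans; exact: addsmxSr.
rewrite -addnn -addSn; apply: leq_trans (rank_central_lt (W := (A + mu Y Z)%MS) A0 _).
  by rewrite !ltnS leq_add2r; apply: rank_ltmx.
move=> v V /sub_addsmxP[[u w] ->] /=.
rewrite linearDl (ad_image_central V (submxMl _ _)) add0r.
by rewrite [w]mx11_scalar mul_scalar_mx linearZl_LR mu_nilp.2 scaler0.
Qed.

End DerivedAlgebra.

(** * Reduction to tensors and the final inequality *)

Theorem proposition9 (K : closedFieldType) (charK : [pchar K] =i pred0)
    (p : nat) (hp : (5 <= p)%N) (mu : bilinear_law K (2 * p + 1)) :
  two_nilp mu ->
  characteristic_sequence mu (rcons (nseq p 2%N) 1%N) ->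
  ~ rigid mu.
Proof.
move=> mu_nilp [[X _ /rank_jordan_type_21 le_p] _].
set A := ad mu X in le_p.
have A0 : A != 0 by rewrite -mxrank_eq0 -lt0n; lia.
have Ac := ad_image_central (X := X) mu_nilp.
(* The image of [A] is itself central, so twice its rank is less than [2 * p + 1]. *)
have rkA : \rank A = p.
  have := rank_central_lt charK mu_nilp A0 Ac.
  by rewrite -/A => lt_n; apply/eqP; rewrite eqn_leq le_p andbT; lia.
have derA Y Z : (mu Y Z <= A)%MS.
  by apply: derived_sub_ad_image => //; rewrite -/A rkA; lia.
(* The rows of [io] form a basis of im(ad X), and [pi] is a surjection with kernel im(ad X), split
   by [pinvmx pi]. *)
pose io := row_base A; pose pi := col_base (cokermx A).
have si_pi : pinvmx pi *m pi = 1%:M by rewrite mulVpmx // col_base_full.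
have modA Y : (Y - Y *m pi *m pinvmx pi <= A)%MS.
  rewrite submxE; apply/eqP.
  transitivity ((Y - Y *m pi *m pinvmx pi) *m (pi *m row_base (cokermx A))).
    by rewrite mulmx_base.
  by rewrite mulmxA mulmxBl -(mulmxA _ _ pi) si_pi mulmx1 subrr mul0mx.
apply: (tensor_law_not_rigid (pi := pi) (si := pinvmx pi) (io := io)
  (rho := pinvmx io)) => //.
- apply: (row_free_inj (row_base_free (cokermx A))).
  rewrite -mulmxA mulmx_base mul0mx; apply/eqP.
  by rewrite -submxE eq_row_base.
- by rewrite mulmxVp // row_base_free.
- move=> Y Z; rewrite mulmxKpV ?eq_row_base //.
  (* By [modA], replacing an argument by the lift of its class changes it by a central element. *)
  rewrite -[Y in LHS](subrK (Y *m pi *m pinvmx pi)) linearDl Ac ?add0r //.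
  rewrite -[Z in LHS](subrK (Z *m pi *m pinvmx pi)) linearDr.
  by rewrite [X in X + _]mu_nilp.1 Ac ?oppr0 ?add0r.
(* With [q = p.+1] and [r = p], the bound needed is (p + 1)^2 + p^2 < p * C(p + 1, 2): it reads 61 <
   75 at p = 5 and fails at p = 4, with 41 against 40. *)
rewrite mxrank_coker rkA (_ : (2 * p + 1 - p = p.+1)%N); last by lia.
have := mul_bin_diag p.+1 1; rewrite bin1 /=; nia.
Qed.
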